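(* Let $\mathfrak{G}_{m,n}$ be the set of (isomorphism classes of) strongly connected directed graphs with $m$ arcs and $n$ nodes. If $\Gamma\in\mathfrak{G}_{m,m}$, then $f_\Gamma=m$. If $1\le n\le m-1$, then for any $\Gamma\in\mathfrak{G}_{m,n}$ the inequality $$f_\Gamma\ge e\,m\,\lambda\,(m-n+1)^{-\lambda}\,\ln(m-n+1),\qquad \lambda=1+\frac{1}{m-n},$$ holds.
   Context: Graphs are finite and directed; loops and multiple (parallel) arcs are allowed. For a graph $\Gamma$ with arc set $\mathcal{A}(\Gamma)$, $f_\Gamma=\min \sum_{a\in\mathcal{A}(\Gamma)} x_a$, the minimum being over all vectors $(x_a)$ with $x_a\ge 0$ such that $\prod_{a\in\gamma}x_a=1$ for every directed cycle $\gamma$ of $\Gamma$ (a closed directed path not passing through the same node twice; loops are cycles of length one). *)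

(* Defs.v *)
From mathcomp Require Import all_boot all_order all_algebra.
From mathcomp Require Import all_classical all_reals all_analysis.

Set Implicit Arguments.
Unset Strict Implicit.
Unset Printing Implicit Defensive.
Import Order.TTheory GRing.Theory Num.Theory.
Import numFieldNormedType.Exports.
Local Open Scope classical_set_scope.
Local Open Scope ring_scope.

(* Arcs form a type of their own, so loops and parallel arcs are allowed. *)
Record digraph := Digraph {
  node : finType;
  arc : finType;
  src : arc -> node;
  tgt : arc -> node }.

Definition adjacent (G : digraph) : rel (node G) :=
  fun u v => [exists a : arc G, (src a == u) && (tgt a == v)].

Definition strongly_connected (G : digraph) : Prop :=
  forall u v : node G, connect (@adjacent G) u v.

(* A directed cycle is the nonempty sequence of its arcs, listed from an
   arbitrary starting node; it visits exactly the sources of these arcs. *)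
Definition directed_cycle (G : digraph) (c : seq (arc G)) : bool :=
  [&& c != [::], cycle (fun a b => tgt a == src b) c & uniq (map (@src G) c)].

Definition feasible (R : realType) (G : digraph) : set {ffun arc G -> R} :=
  [set x | (forall a, 0 <= x a) /\
           (forall c, directed_cycle c -> \prod_(a <- c) x a = 1)].
Arguments feasible : clear implicits.

(* The infimum is always a minimum, see [fGamma_attained]. *)
Definition fGamma (R : realType) (G : digraph) : R :=
  inf [set \sum_a x a | x in feasible R G].
Arguments fGamma : clear implicits.

(* Being in the class is invariant under isomorphism: its members are the
   representatives of the isomorphism classes. *)
Definition graph_class (m n : nat) (G : digraph) : Prop :=
  [/\ strongly_connected G, #|arc G| = m & #|node G| = n].

Lemma fGamma_attained (R : realType) (G : digraph) :
  exists2 x, feasible R G x &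
    fGamma R G = \sum_a x a /\
    forall y, feasible R G y -> \sum_a x a <= \sum_a y a.
Proof.
pose n := #|arc G|.
pose X (v : 'rV[R]_n) : {ffun arc G -> R} := [ffun a => v 0 (enum_rank a)].
have cX a : continuous (fun v => X v a).
  rewrite (_ : (fun v => X v a) = fun v : 'rV[R]_n => v 0 (enum_rank a)).
    exact: coord_continuous.
  by apply/funext => v; rewrite ffunE.
have cS : continuous (fun v => \sum_a X v a).
  by apply: continuous_big => //; exact: add_continuous.
have cP (c : seq (arc G)) : continuous (fun v => \prod_(a <- c) X v a).
  by apply: continuous_big => //; exact: mul_continuous.
have X1 : X (const_mx 1) = [ffun=> 1] by apply/ffunP => a; rewrite !ffunE mxE.
have f1 : feasible R G (X (const_mx 1)).
  rewrite X1; split=> [a|c _]; first by rewrite ffunE.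
  by rewrite big1 // => a _; rewrite ffunE.
pose K := [set v | feasible R G (X v) /\ \sum_a X v a <= n%:R].
have sum1 : \sum_a X (const_mx 1) a = n%:R.
  by rewrite X1 (eq_bigr (fun=> 1)) ?sumr_const // => a _; rewrite ffunE.
have K1 : K (const_mx 1) by split; rewrite ?sum1.
have closK : closed K.
  rewrite (_ : K = \bigcap_a (fun v => X v a) @^-1` [set t | 0 <= t] `&`
    \bigcap_(c in [set c | directed_cycle c])
       (fun v => \prod_(a <- c) X v a) @^-1` [set t | t = 1] `&`
    (fun v => \sum_a X v a) @^-1` [set t | t <= n%:R]); last first.
    apply/seteqP; split=> v.
      move=> [[v0 v1] vn]; split=> //.
      by split=> [a _|c cc]; [exact: v0|exact: v1].
    by move=> [[v0 v1] vn]; split=> //; split=> [a|c cc]; [exact: v0|exact: v1].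
  apply: closedI; first apply: closedI.
  - apply: closed_bigI => a _; apply: preimage_closed; last exact: closed_ge.
    by move=> v _; exact: cX.
  - apply: closed_bigI => c _; apply: preimage_closed; last exact: closed_eq.
    by move=> v _; exact: cP.
  - apply: preimage_closed; last exact: closed_le.
    by move=> v _; exact: cS.
have bndK : bounded_set K.
  exists n%:R; split=> // M /ltW nM v [[v0 _] vn].
  rewrite /= [leLHS]/Num.norm /= mx_normrE; apply/bigmax_leP.
  split=> [|[i j] _ /=]; first exact: le_trans nM.
  have Xj : X v (enum_val j) = v i j by rewrite ffunE enum_valK ord1.
  rewrite -Xj ger0_norm ?v0 //; apply: le_trans nM; apply: le_trans vn.
  by rewrite (bigD1 (enum_val j)) //= lerDl sumr_ge0.
have [v /set_mem[fv vn] minv] : exists2 c, c \in K &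
    forall t, t \in K -> \sum_a X c a <= \sum_a X t a.
  apply: (@compact_EVT_min _ _ (fun v => \sum_a X v a)).
    by exists (const_mx 1).
    exact: bounded_closed_compact.
  exact: continuous_subspaceT.
have min y : feasible R G y -> \sum_a X v a <= \sum_a y a.
  move=> fy; have [yn|/ltW ny] := leP (\sum_a y a) n%:R; last exact: le_trans ny.
  pose w : 'rV[R]_n := \row_j y (enum_val j).
  have Xw : X w = y by apply/ffunP => a; rewrite ffunE mxE enum_rankK.
  by rewrite -Xw; apply: minv; apply/mem_set; split; rewrite Xw.
exists (X v) => //; split=> //; apply/eqP; rewrite eq_le; apply/andP; split.
  apply: ge_inf; last by exists (X v).
  by exists (\sum_a X v a) => _ [y fy <-]; exact: min.
apply: lb_le_inf; first by exists (\sum_a X v a), (X v).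
by move=> _ [y fy <-]; exact: min.
Qed.

(* Main.v *)
(** If [s] is a list of cycles covering every arc and [q a] is the number of
    cycles of [s] through [a], then [\sum_a q a * ln (x a) = 0] for every
    feasible [x].  Cycles chosen greedily, each through an arc not covered yet,
    have linearly independent indicator vectors in the left kernel of the
    incidence matrix, which has dimension at most [k = m - n + 1]; hence
    [1 <= q <= k].  For [c > 0], the inequality [1 + ln t <= t] at
    [t = x a / (c * q a)] gives
    [\sum_a x a >= c * \sum_a q a * (1 - ln c - ln (q a))].  Each summand is
    concave in [q a], and [c = e * k^(-lambda)] is the value at which it is the
    same at the two ends of [[1, k]]. *)
From mathcomp Require Import all_boot all_order all_algebra.
From mathcomp Require Import all_classical all_reals all_analysis.
From mathcomp Require Import ring lra zify.
Require Import Defs.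
Import Order.TTheory GRing.Theory Num.Theory.
Local Open Scope ring_scope.

(** * Cycle vectors and a small cover of the arcs by directed cycles *)

Section Cycles.
Variable G : digraph.
Implicit Types (a : arc G) (c : seq (arc G)) (s : seq (seq (arc G))).

Let follows : rel (arc G) := fun a b => tgt a == src b.

Lemma path_adjacent_arcs a (p : seq (node G)) : path (@adjacent G) (tgt a) p ->
  exists c, [/\ path follows a c, map (@src G) c = belast (tgt a) p
              & tgt (last a c) = last (tgt a) p].
Proof.
elim: p a => [|v p IH] a /=; first by exists [::].
case/andP=> /existsP[b /andP[/eqP sb /eqP tb]]; rewrite -tb => /IH[c [pc sc lc]].
by exists (b :: c); rewrite /= /follows sb eqxx pc sc lc.
Qed.

(** A simple path from [tgt a] back to [src a], closed up by [a], is a cycle; the path may be empty,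
    when [a] is a loop. *)
Lemma directed_cycle_through a : strongly_connected G ->
  exists2 c, directed_cycle c & a \in c.
Proof.
move=> sG; have /connectP[p0 pp0] := sG (tgt a) (src a).
case/shortenP: pp0 => p pp up _ def.
have [c [pc sc lc]] := path_adjacent_arcs a p pp.
exists (a :: c); last exact: mem_head.
rewrite /directed_cycle /= rcons_path -/follows pc /= lc -def eqxx /=.
(* The sources are the nodes of the simple path, with its last node [src a] moved to the front. *)
by rewrite sc def -rcons_uniq -lastI.
Qed.

Lemma directed_cycle_uniq c : directed_cycle c -> uniq c.
Proof. by case/and3P=> _ _ /map_uniq. Qed.

Lemma directed_cycle_telescope (V : zmodType) (f : node G -> V) c :
  directed_cycle c -> \sum_(a <- c) (f (tgt a) - f (src a)) = 0.
Proof.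
have tele a p : path follows a p ->
    \sum_(b <- a :: p) (f (tgt b) - f (src b)) = f (tgt (last a p)) - f (src a).
  elim: p a => [|b p IH] a /=; first by rewrite big_seq1.
  by case/andP=> /eqP ab /IH pb; rewrite big_cons pb ab addrC addrA subrK.
case/and3P; case: c => // a c _ + _; rewrite [cycle _ _]/= rcons_path.
by case/andP=> /tele -> /eqP ->; rewrite subrr.
Qed.

(** Rows are indexed by arcs, so that cycles act as row vectors from the left; a loop gives a zero
    row. *)
Definition incidence : 'M[rat]_(#|arc G|, #|node G|) :=
  \matrix_i (delta_mx 0 (enum_rank (tgt (enum_val i)))
             - delta_mx 0 (enum_rank (src (enum_val i)))).

Definition cycle_vector c : 'rV[rat]_#|arc G| :=
  \sum_(a <- c) delta_mx 0 (enum_rank a).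

Lemma cycle_vectorE c j : cycle_vector c 0 j = (count_mem (enum_val j) c)%:R.
Proof.
rewrite /cycle_vector summxE -sum1_count natr_sum [RHS]big_mkcond.
apply: eq_bigr => a _; rewrite mxE eqxx /= -(can_eq enum_rankK) enum_valK eq_sym.
by case: eqP.
Qed.

Lemma cycle_vector_incidence c :
  directed_cycle c -> cycle_vector c *m incidence = 0.
Proof.
move=> cc; rewrite mulmx_suml.
rewrite -[RHS](directed_cycle_telescope _ (fun v => delta_mx 0 (enum_rank v)) _ cc).
by apply: eq_bigr => a _; rewrite -rowE rowK enum_rankK.
Qed.

(** A vector killed by the transpose is a function on nodes that is constant along arcs, hence
    constant by strong connectivity; such functions span dimension at most one. *)
Lemma rank_incidence : strongly_connected G ->
  (#|node G| <= (\rank incidence).+1)%N.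
Proof.
move=> sG; rewrite -(mxrank_tr incidence).
suff : (\rank (kermx incidence^T) <= 1)%N.
  by rewrite mxrank_ker leq_subLR addn1.
apply: leq_trans (rank_leq_row (const_mx 1 : 'rV[rat]_#|node G|)).
apply: mxrankS; apply/rV_subP => u /sub_kermxP u0.
have step v w : adjacent v w -> u 0 (enum_rank v) = u 0 (enum_rank w).
  case/existsP=> a /andP[/eqP <- /eqP <-].
  have /matrixP/(_ 0 (enum_rank a)) := u0; rewrite !mxE => /eqP.
  under eq_bigr do rewrite !mxE enum_rankK mulrBr.
  rewrite sumrB subr_eq0 => /eqP.
  have pick v' : \sum_i u 0 i * ((0 == 0 :> 'I_1) && (i == enum_rank v'))%:R
      = u 0 (enum_rank v').
    rewrite (bigD1 (enum_rank v')) //= eqxx mulr1 big1 ?addr0 // => i /negbTE ->.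
    by rewrite mulr0.
  by rewrite !pick.
have const v w : u 0 (enum_rank v) = u 0 (enum_rank w).
  have /connectP[p + ->] := sG v w.
  by elim: p v => //= z p IH v /andP[/step -> /IH].
(* Without nodes there is no entry from which to read the constant. *)
case: (posnP #|node G|) => [n0|n0].
  by rewrite (_ : u = 0) ?sub0mx //; apply/rowP=> j; have := ltn_ord j; rewrite {2}n0.
apply/sub_rVP; exists (u 0 (Ordinal n0)); apply/rowP=> j; rewrite !mxE mulr1.
by rewrite -(enum_valK j) -(enum_valK (Ordinal n0)); exact: const.
Qed.

(** Lists grow at the head: each cycle has an arc missed by all cycles chosen before it, which makes
    the family triangular. *)
Fixpoint fresh s : bool :=
  if s is c :: s' then has (fun a => a \notin flatten s') c && fresh s' else true.

Lemma fresh_size s :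
  strongly_connected G -> all (@directed_cycle G) s -> fresh s ->
  (size s + #|node G| <= #|arc G|.+1)%N.
Proof.
move=> sG cs fs; pose V := (\sum_(c <- s) <<cycle_vector c>>)%MS.
have span_le (t : seq (seq (arc G))) n (K : 'M[rat]_(n, #|arc G|)) :
    (forall c, c \in t -> (cycle_vector c <= K)%MS) ->
    (\sum_(c <- t) <<cycle_vector c>> <= K)%MS.
  elim: t => [|c t IH] ct; first by rewrite big_nil sub0mx.
  rewrite big_cons addsmx_sub genmxE ct ?mem_head //= IH // => d dt.
  by rewrite ct // inE dt orbT.
have rV : (size s <= \rank V)%N.
  rewrite {}/V; elim: s fs {cs} => //= c s IH /andP[/hasP[a ac as_] /IH].
  move=> /leq_ltn_trans; apply; rewrite big_cons.
  suff : (\sum_(d <- s) <<cycle_vector d>>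
      < <<cycle_vector c>> + \sum_(d <- s) <<cycle_vector d>>)%MS.
    by rewrite ltmxErank => /andP[].
  rewrite ltmxE addsmxSr addsmx_sub submx_refl andbT genmxE; apply/negP => cV.
  (* [K] is the hyperplane of vectors vanishing at [a]: it contains the vectors of all cycles in
     [s], but not that of [c]. *)
  pose K := kermx (delta_mx (enum_rank a) 0 : 'cV[rat]_#|arc G|).
  have inK d : (cycle_vector d <= K)%MS = (a \notin d).
    rewrite (sameP sub_kermxP eqP) -colE -has_pred1 has_count -eqn0Ngt.
    apply/eqP/eqP => [/matrixP/(_ 0 0)|a0]; last first.
      by apply/colP=> i; rewrite ord1 !mxE cycle_vectorE enum_rankK a0.
    by rewrite !mxE cycle_vectorE enum_rankK => /eqP; rewrite pnatr_eq0 => /eqP.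
  have := submx_trans cV (span_le s _ K _); rewrite inK ac => /(_ _)/negP[] // d ds.
  by rewrite inK; apply: contra as_ => ad; apply/flattenP; exists d.
have VA : V *m incidence = 0.
  apply/sub_kermxP/span_le => c /(allP cs) /cycle_vector_incidence.
  by move/sub_kermxP.
have := mulmx0_rank_max VA; have := rank_incidence sG; move: rV; lia.
Qed.

Lemma cycle_cover : strongly_connected G ->
  exists s, [/\ all (@directed_cycle G) s, (forall a, a \in flatten s)
              & (size s + #|node G| <= #|arc G|.+1)%N].
Proof.
move=> sG.
(* [d] bounds the number of arcs still uncovered, and each added cycle lowers that number. *)
suff extend d s : all (@directed_cycle G) s -> fresh s ->
    (#|[pred a | a \notin flatten s]| <= d)%N ->
    exists t, [/\ all (@directed_cycle G) t, fresh t & forall a, a \in flatten t].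
  have [|t [ct ft at_]] := extend #|arc G| [::] isT isT; first exact: max_card.
  by exists t; split=> //; exact: fresh_size.
elim: d s => [|d IH] s cs fs.
  rewrite leqn0 => /eqP /card0_eq s0; exists s; split=> // a.
  by have := s0 a; rewrite !inE => /negbFE.
move=> sd; have [/forallP all_|] := boolP [forall a, a \in flatten s].
  by exists s.
rewrite negb_forall => /existsP[a as_].
have [c cc ac] := directed_cycle_through a sG.
apply: (IH (c :: s)); rewrite /= ?cc ?cs ?fs //.
  by rewrite andbT; apply/hasP; exists a.
rewrite -ltnS; apply: leq_trans sd; apply: proper_card; apply/properP; split.
  by apply/fintype.subsetP=> b; rewrite !inE mem_cat negb_or => /andP[].
by exists a; rewrite !inE ?mem_cat ?ac.
Qed.

Lemma count_flatten_cycles s a : all (@directed_cycle G) s ->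
  (count_mem a (flatten s) <= size s)%N.
Proof.
elim: s => //= c s IH /andP[/directed_cycle_uniq uc /IH].
by rewrite count_cat (count_uniq_mem a uc); case: (a \in c); lia.
Qed.

End Cycles.

(** * From a vanishing weighted sum of logarithms to a lower bound on the sum *)

Section Bound.
Variable R : realType.
Implicit Types (k q t y : R).

Lemma ln_le_subr1 y : 0 < y -> ln y <= y - 1.
Proof. by move=> y0; rewrite -{1}(subrKC 1 y) le_ln1Dx // ltrBrDl subrr. Qed.

Lemma ln_prod (I : Type) (r : seq I) (x : I -> R) : (forall i, 0 < x i) ->
  ln (\prod_(i <- r) x i) = \sum_(i <- r) ln (x i).
Proof.
move=> x0; elim: r => [|i r IH]; first by rewrite !big_nil ln1.
by rewrite !big_cons lnM ?IH // posrE ?prodr_gt0.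
Qed.

Lemma sum_count_mem (I : finType) (r : seq I) (F : I -> R) :
  \sum_(i <- r) F i = \sum_i (count_mem i r)%:R * F i.
Proof.
elim: r => [|j r IH]; first by rewrite big_nil big1 // => i _; rewrite mul0r.
rewrite big_cons IH (bigD1 j) //= [RHS](bigD1 j) //= eqxx natrD mulrDl mul1r addrA.
by congr (_ + _); apply: eq_bigr => i /negbTE; rewrite eq_sym => ->.
Qed.

(** The convex function [t * ln t], zero at [1], lies below its chord over [[1, k]]. The tangent at
    [q] is compared with the function at [1] and [k]; with weights [k - q] and [q - 1] the slope
    terms cancel. *)
Lemma mulr_ln_chord k q : 1 <= q <= k ->
  (k - 1) * (q * ln q) <= (q - 1) * (k * ln k).
Proof.
case/andP=> q1 qk; have q0 : 0 < q by lra.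
have tangent y : 0 < y -> (ln q + 1) * (y - q) <= y * ln y - q * ln q.
  move=> y0; have := ln_le_subr1 (q / y) (divr_gt0 q0 y0).
  rewrite ln_div ?posrE // -(ler_pM2l y0).
  by rewrite [y * (q / y - 1)](_ : _ = q - y); [lra | field; lra].
have := tangent 1 ltr01; rewrite ln1 => h1.
have := tangent k ltac:(lra) => hk.
have := ler_wpM2l (_ : 0 <= k - q) h1; have := ler_wpM2l (_ : 0 <= q - 1) hk.
by lra.
Qed.

Lemma sum_ge_weighted_ln (I : finType) (x q : I -> R) k lambda :
  1 < k -> lambda = 1 + 1 / (k - 1) -> (forall i, 0 < x i) -> (forall i, 1 <= q i <= k) ->
  \sum_i q i * ln (x i) = 0 ->
  expR 1 * #|I|%:R * lambda * k `^ (- lambda) * ln k <= \sum_i x i.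
Proof.
move=> k1 lambdaE x0 qk qx; have k0 : 0 < k by lra.
pose c := expR 1 * k `^ (- lambda).
have c0 : 0 < c by rewrite mulr_gt0 ?expR_gt0 ?powR_gt0.
have lnc : ln c = 1 - lambda * ln k.
  by rewrite lnM ?posrE ?expR_gt0 ?powR_gt0 // expRK ln_powR mulNr.
(* The first term does not depend on [i], and the second ones cancel in the sum by [qx]. *)
have le i : c * (lambda * ln k + q i * ln (x i)) <= x i.
  have /andP[q1 _] := qk i; have q0 : 0 < q i by lra.
  have cq0 : 0 < c * q i by rewrite mulr_gt0.
  have := ln_le_subr1 (x i / (c * q i)) (divr_gt0 (x0 i) cq0).
  rewrite ln_div ?posrE // lnM ?posrE // lnc -(ler_pM2l cq0).
  rewrite [leRHS](_ : _ = x i - c * q i); last first.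
    by field; rewrite !gt_eqF.
  have : q i * ln (q i) <= (q i - 1) * (lambda * ln k).
    (* Since [lambda = k / (k - 1)], the slope of the chord is [lambda * ln k]. *)
    have -> : lambda * ln k = k * ln k / (k - 1).
      by rewrite lambdaE; field; rewrite subr_eq0 gt_eqF.
    rewrite mulrA ler_pdivlMr ?subr_gt0 // mulrC; exact: mulr_ln_chord.
  by move=> /(ler_wpM2l (ltW c0)); clearbody c; lra.
have -> : expR 1 * #|I|%:R * lambda * k `^ (- lambda) * ln k =
    \sum_i c * (lambda * ln k + q i * ln (x i)).
  rewrite -mulr_sumr big_split /= qx sumr_const -mulr_natr /c addr0; ring.
by apply: ler_sum => i _; exact: le.
Qed.

End Bound.

(** * Logarithms of feasible vectors *)

Section Feasible.
Variables (R : realType) (G : digraph) (x : {ffun arc G -> R}).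
Hypotheses (sG : strongly_connected G) (fx : feasible R G x).

(** Every arc lies on a cycle, whose product [1] excludes a zero factor. *)
Lemma feasible_gt0 a : 0 < x a.
Proof.
have [x0 x1] := fx; have [c cc ac] := directed_cycle_through G a sG.
rewrite lt0r x0 andbT; apply/eqP => xa0; have /eqP := x1 c cc.
by rewrite (big_rem a ac) /= xa0 mul0r eq_sym oner_eq0.
Qed.

(** The logarithm of the product along each cycle of a cover is zero; adding these up counts each
    arc once per covering cycle, hence at most as often as there are cycles. *)
Lemma feasible_weights : exists q : arc G -> nat,
  (forall a, 1 <= q a <= #|arc G|.+1 - #|node G|)%N /\
  \sum_a (q a)%:R * ln (x a) = 0.
Proof.
have [s [cs as_ ss]] := cycle_cover G sG.
exists (fun a => count_mem a (flatten s)); split=> [a|].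
  rewrite -has_count has_pred1 as_ /=.
  apply: leq_trans (count_flatten_cycles G s a cs) _.
  by rewrite -(addnK #|node G| (size s)) leq_sub2r.
rewrite -sum_count_mem big_flatten /= big_seq big1 // => c /(allP cs) cc.
by rewrite -ln_prod ?fx.2 ?ln1 //; exact: feasible_gt0.
Qed.

End Feasible.

Theorem mainTheorem6 (R : realType) (m n : nat) (G : digraph)
    (hG : graph_class m n G) :
  (n = m -> fGamma R G = m%:R) /\
  ((1 <= n <= m - 1)%N ->
     let lambda : R := 1 + 1 / (m%:R - n%:R) in
     let k : R := m%:R - n%:R + 1 in
     expR 1 * m%:R * lambda * k `^ (- lambda) * ln k <= fGamma R G).
Proof.
case: hG => sG mG nG.
have [x fx [-> minx]] := fGamma_attained R G.
have x0 := feasible_gt0 R G x sG fx.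
have [q [qk qx]] := feasible_weights R G x sG fx; rewrite mG nG in qk.
split=> [nm|/andP[n1 nm]].
  (* For [n = m] the upper bound on the weights is [1]. *)
  have q1 a : q a = 1%N by have := qk a; rewrite nm subSnn; lia.
  (* The all-ones vector gives the upper bound; the lower one sums [ln (x a) <= x a - 1], whose left
     sides add up to zero. *)
  apply/eqP; rewrite eq_le; apply/andP; split.
    have f1 : feasible R G [ffun=> 1].
      by split=> [a|c _]; rewrite ?ffunE // big1 // => a _; rewrite ffunE.
    apply: le_trans (minx _ f1) _; rewrite (eq_bigr (fun=> 1)) => [|a _].
      by rewrite sumr_const -mG.
    by rewrite ffunE.
  rewrite -subr_ge0 -mG -[#|_|%:R]sumr_const -sumrB -[leLHS]qx.
  by apply: ler_sum => a _; rewrite q1 mul1r ln_le_subr1.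
have nm' : n%:R + 1 <= m%:R :> R by rewrite natr1 ler_nat; lia.
rewrite -mG; apply: sum_ge_weighted_ln qx => // [||a]; rewrite mG ?addrK //; first lra.
have /andP[qa1 qak] := qk a; rewrite ler1n qa1 /=.
(* The truncated subtraction in [qk] is removed before casting to [R]. *)
have : (q a + n <= m.+1)%N by lia.
by rewrite -(ler_nat R) natrD -natr1; lra.
Qed.
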